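(* Let $G=G_1\oplus G_2$ be a finitely generated abelian group with $G_1\cong\mathbb{Z}^m$ and $G_2\cong\bigoplus_{i=1}^l\mathbb{Z}_{q_i}$, let $S$ be a finite symmetric generating set of $G$, and let $d\ge 0$ be real. Then $$H^d(G,S)=H^d(G_1,\pi_{G_1}S),$$ where a function $g$ on $G_1$ is identified with the function $g\circ\pi_{G_1}$ on $G$. Moreover, any $f\in H^d(G,S)$ is a polynomial when restricted to $G_1\cong\mathbb{Z}^m$, and it is constant on $G_2$, i.e. $f(x+w)=f(x)$ for all $x\in G$ and all $w\in G_2$.
   Context: Group: $m\ge 1$ and $l\ge 0$ are integers ($l=0$ being the torsion-free case), and each $q_i=p_i^{a_i}$ is a prime power. $\pi_{G_1}:G\to G_1$ is the projection $x_1+x_2\mapsto x_1$ ($x_1\in G_1$, $x_2\in G_2$). Generating sets: a finite symmetric generating set is a finite list $S=(s_1,\dots,s_{2r})$ of elements generating $G$ with $s_{i+r}=-s_i$ for $1\le i\le r$; repetitions are allowed and $0\in S$ is allowed. $\pi_{G_1}S=(\pi_{G_1}s_1,\dots,\pi_{G_1}s_{2r})$, taken as a list (keeping repetitions and zeros), is a finite symmetric generating set of $G_1$. The Cayley graph $(G,S)$ has vertex set $G$ and $x\sim y$ iff $y-x\in S$; sums over $y\sim x$ are taken with multiplicity, i.e. $\sum_{y\sim x}h(y)=\sum_{i=1}^{2r}h(x+s_i)$. $d^S$ is the word metric (length of a shortest path in the Cayley graph). Laplacian: $L^Su(x)=\sum_{y\sim x}(u(y)-u(x))$. Polynomial growth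 harmonic functions: for a fixed base point $p\in G$, $$H^d(G,S)=\{u:G\to\mathbb{R}\mid L^Su=0 \text{ on } G,\ \exists C:\ |u(x)|\le C(d^S(p,x)+1)^d\ \forall x\in G\};$$ $H^d(G_1,\pi_{G_1}S)$ is defined in the same way for the group $G_1$ with generating set $\pi_{G_1}S$. A function on $\mathbb{Z}^m$ is called a polynomial if it is the restriction to $\mathbb{Z}^m$ of a real polynomial on $\mathbb{R}^m$. *)

(* Defs.v *)
From HB Require Import structures.
From mathcomp Require Import all_boot all_order all_algebra.
From mathcomp Require Import all_classical all_reals all_analysis.
(* Not imported: the notations of mpoly clash with those of analysis. *)
From mathcomp Require mpoly.

Set Implicit Arguments.
Unset Strict Implicit.
Unset Printing Implicit Defensive.

Import Order.TTheory GRing.Theory Num.Theory.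

Local Open Scope classical_set_scope.
Local Open Scope ring_scope.

Definition generates (G : zmodType) (S : seq G) : Prop :=
  forall H : set G,
    H 0 -> (forall x y, H x -> H y -> H (x - y)) ->
    (forall s, s \in S -> H s) -> forall x, H x.

(* A list, so that repetitions and 0 are allowed and [map] keeps both. *)
Definition sym_generating (G : zmodType) (S : seq G) : Prop :=
  (exists2 r : nat, size S = (2 * r)%N
     & forall i, (i < r)%N -> S`_(i + r) = - S`_i)
  /\ generates S.

Section Cayley.
Variables (G : zmodType) (S : seq G).

Definition cayley : rel G := fun x y => y - x \in S.

Definition has_walk (x y : G) (n : nat) : Prop :=
  exists w : seq G, [/\ path cayley x w, last x w = y & size w = n].

(* The default value 0 is never reached when S generates G. *)
Definition word_dist (x y : G) : nat :=
  if pselect (exists n, `[< has_walk x y n >]) is left h then ex_minn h else 0%N.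

Variable R : realType.

(* Summing over the list S counts neighbours with multiplicity. *)
Definition laplacian (u : G -> R) (x : G) : R :=
  \sum_(s <- S) (u (x + s) - u x).

Definition harmonic_growth (d : R) (p : G) : set (G -> R) :=
  [set u | (forall x, laplacian u x = 0)
         /\ exists C : R, forall x,
              `|u x| <= C * ((word_dist p x)%:R + 1) `^ d].

End Cayley.

Definition is_polynomial (R : realType) (m : nat) (h : 'rV[int]_m -> R) : Prop :=
  exists P : mpoly.mpoly m R,
    forall z, h z = mpoly.meval (fun i => (z 0 i)%:~R) P.

(* Additivity is componentwise because {dffun _} carries no zmodType instance.
   'Z_n is the ring of integers mod n only for n > 1. *)
Definition iso_cyclic_sum (l : nat) (q : 'I_l -> nat) (A : zmodType) : Prop :=
  exists psi : A -> {dffun forall i : 'I_l, 'Z_(q i)},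
    bijective psi /\ forall x y i, psi (x + y) i = psi x i + psi y i.

(* Main.v *)
(* For u harmonic on a finitely generated abelian group, the differences
   D_s u are harmonic and L(u^2) = sum_s (D_s u)^2, so by induction
   L^k(u^2) = sum over s_1, ..., s_k in S of (D_{s_1} ... D_{s_k} u)^2 >= 0.
   With N = |S|, the operator (N + L)^n sums a function over all walks of length
   n, and its binomial expansion on u^2 has nonnegative terms; hence
   C(n,k) N^(n-k) L^k(u^2)(x) is at most N^n times the maximum of u^2 on the ball
   of radius n around x.  If |u| grows with exponent d and k > 2d, letting n tend
   to infinity gives L^k(u^2) = 0: all k-fold differences of u vanish.  Such a
   function is invariant under torsion elements, and is a polynomial on Z^m by
   Newton's expansion in each coordinate.  The two growth conditions agree because
   walks in the quotient lift to walks in G. *)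

Require Import Defs.
From HB Require Import structures.
From mathcomp Require Import all_boot all_order all_algebra.
From mathcomp Require Import all_classical all_reals all_analysis.
From mathcomp Require mpoly.
Import (canonicals) mpoly.
From mathcomp Require Import zify ring lra.

Set Implicit Arguments.
Unset Strict Implicit.
Unset Printing Implicit Defensive.

Import Order.TTheory GRing.Theory Num.Theory.

Local Open Scope classical_set_scope.
Local Open Scope ring_scope.

(** * Word distance *)

Section WordDistance.
Variable G : zmodType.
Implicit Types (S : seq G) (x y z : G).

Lemma has_walk0 S x : has_walk S x x 0.
Proof. by exists [::]. Qed.

Lemma has_walkS S x y n :
  has_walk S x y n.+1 <-> exists2 s, s \in S & has_walk S (x + s) y n.
Proof.
split=> [[[|z w] [] //= /andP[xz pw] lw [sw]]|[s sS [w [pw lw sw]]]].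
  by exists (z - x) => //; exists w; rewrite addrC subrK.
by exists (x + s :: w); split; rewrite /= ?sw // /cayley addrC addKr sS.
Qed.

Lemma has_walk_cat S x y z n k :
  has_walk S x y n -> has_walk S y z k -> has_walk S x z (n + k).
Proof.
elim: n x => [|n IH] x; first by case=> -[|? ?] [_ /= <- //].
move=> /has_walkS[s sS /IH{}IH] /IH yz; apply/has_walkS; by exists s.
Qed.

Lemma has_walk1 S x s : s \in S -> has_walk S x (x + s) 1.
Proof. by move=> sS; apply/has_walkS; exists s => //; apply: has_walk0. Qed.

Lemma sym_generatingN S s : sym_generating S -> s \in S -> - s \in S.
Proof.
move=> [[r szS symS] _] /(nthP 0)[i]; rewrite szS => ir <-.
have [ir'|ri] := ltnP i r.
  by rewrite -symS // mem_nth // szS; lia.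
rewrite -(subnK ri) symS ?opprK ?mem_nth // ?szS; lia.
Qed.

Lemma has_walk_sym S x y n :
  sym_generating S -> has_walk S x y n -> has_walk S y x n.
Proof.
move=> gS; elim: n x => [|n IH] x.
  by case=> -[|? ?] [_ /= <- // _]; apply: has_walk0.
move=> /has_walkS[s sS /IH yx]; rewrite -addn1; apply: has_walk_cat yx _.
by rewrite -[X in has_walk _ _ X](addrK s); apply/has_walk1/sym_generatingN.
Qed.

Lemma has_walk_ex S x y : sym_generating S -> exists n, has_walk S x y n.
Proof.
move=> gS; rewrite -(subrK x y) (addrC _ x).
(* Displacements reachable from every point form a subgroup: walks concatenate, and symmetry of [S]
   reverses them. *)
apply: (gS.2 (fun v => forall x, exists n, has_walk S x (x + v) n)) => {x y}.
- by move=> x; rewrite addr0; exists 0%N; apply: has_walk0.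
- move=> v w Hv Hw x; have [n xv] := Hv x; have [k wx] := Hw (x + v - w).
  exists (n + k)%N; apply: has_walk_cat xv _; apply: has_walk_sym => //.
  by move: wx; rewrite subrK addrA.
- by move=> s sS x; exists 1%N; apply: has_walk1.
Qed.

Lemma word_distP S x y :
  sym_generating S -> has_walk S x y (word_dist S x y).
Proof.
move=> gS; rewrite /word_dist; case: pselect => [h|].
  by case: ex_minnP => n /asboolP.
by case; have [n] := has_walk_ex x y gS; exists n; apply/asboolP.
Qed.

Lemma word_dist_le S x y n : has_walk S x y n -> (word_dist S x y <= n)%N.
Proof.
move=> xy; rewrite /word_dist; case: pselect => [h|//].
by case: ex_minnP => k _; apply; apply/asboolP.
Qed.

Lemma word_distD S x y z : sym_generating S ->
  (word_dist S x z <= word_dist S x y + word_dist S y z)%N.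
Proof.
by move=> gS; apply/word_dist_le/has_walk_cat; exact: word_distP.
Qed.

Lemma word_distDr S x y s : sym_generating S -> s \in S ->
  (word_dist S x (y + s) <= (word_dist S x y).+1)%N.
Proof.
move=> gS sS; rewrite -addn1; apply/word_dist_le/has_walk_cat/has_walk1 => //.
exact: word_distP.
Qed.

End WordDistance.

(** * Walks under the projection and their lifts *)

Section Projection.
Variables (G1 G2 : zmodType).
Implicit Types (S : seq (G1 * G2)) (x : G1 * G2).

Lemma sym_generating_fst S :
  sym_generating S -> sym_generating [seq s.1 | s <- S].
Proof.
move=> [[r szS symS] gS]; split.
  exists r => [|i ir]; first by rewrite size_map.
  rewrite !(nth_map 0) ?szS ?symS //; lia.
move=> H H0 HB HS x; apply: (gS (fun v => H v.1) _ _ _ (x, 0)) => //.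
  by move=> v w; apply: HB.
by move=> s sS; apply/HS/map_f.
Qed.

Lemma has_walk_fst S x (y : G1 * G2) n :
  has_walk S x y n -> has_walk [seq s.1 | s <- S] x.1 y.1 n.
Proof.
elim: n x => [|n IH] x; first by case=> -[|? ?] [_ /= <- // _]; apply: has_walk0.
by move=> /has_walkS[s sS /IH xy]; apply/has_walkS; exists s.1; rewrite ?map_f.
Qed.

Lemma has_walk_lift S x (y1 : G1) n : has_walk [seq s.1 | s <- S] x.1 y1 n ->
  exists y2, has_walk S x (y1, y2) n.
Proof.
elim: n x => [|n IH] x.
  by case=> -[|? ?] [_ /= <- // _]; exists x.2; case: x => *; apply: has_walk0.
move=> /has_walkS[s1 /mapP[s sS ->] xy].
have [y2 xy2] := IH (x + s) xy.
by exists y2; apply/has_walkS; exists s.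
Qed.

Lemma word_dist_fst S x (y : G1 * G2) : sym_generating S ->
  (word_dist [seq s.1 | s <- S] x.1 y.1 <= word_dist S x y)%N.
Proof. by move=> gS; apply/word_dist_le/has_walk_fst/word_distP. Qed.

(** The lift of a shortest walk decides [y2]; invariance along [G2] later makes its value
    irrelevant. *)
Lemma word_dist_lift S x (y1 : G1) : sym_generating S ->
  exists y2, (word_dist S x (y1, y2) <= word_dist [seq s.1 | s <- S] x.1 y1)%N.
Proof.
move=> gS.
have [y2 xy] := has_walk_lift (word_distP x.1 y1 (sym_generating_fst gS)).
by exists y2; apply: word_dist_le.
Qed.

End Projection.

(** * Finite differences *)

Section Difference.
Variables (G V : zmodType).
Implicit Types (u v : G -> V) (s x y : G).

Definition diff s u : G -> V := fun x => u (x + s) - u x.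

(* The [k]-fold differences of [u] vanish, i.e. [u] is a polynomial map of
   degree less than [k]. *)
Fixpoint nil_diff (k : nat) (u : G -> V) : Prop :=
  if k is k'.+1 then forall s, nil_diff k' (diff s u) else forall x, u x = 0.

Lemma diff_translate s y u :
  diff s (fun x => u (x + y)) = (fun x => diff s u (x + y)).
Proof. by apply/funext => x; rewrite /diff addrAC. Qed.

Lemma diffB s u v : diff s (fun x => u x - v x) = (fun x => diff s u x - diff s v x).
Proof. by apply/funext => x; rewrite /diff !opprD !opprK addrACA. Qed.

Lemma nil_diff_translate k y u : nil_diff k u -> nil_diff k (fun x => u (x + y)).
Proof.
elim: k u => [|k IH] u /= uk; first by move=> x; rewrite uk.
by move=> s; rewrite diff_translate; apply: IH.
Qed.

Lemma nil_diffB k u v :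
  nil_diff k u -> nil_diff k v -> nil_diff k (fun x => u x - v x).
Proof.
elim: k u v => [|k IH] u v /= uk vk; first by move=> x; rewrite uk vk subr0.
by move=> s; rewrite diffB; apply: IH.
Qed.

Lemma nil_diff_const0 k : nil_diff k (fun=> 0).
Proof.
elim: k => [//|k IH] s; rewrite (_ : diff s _ = fun=> 0) //.
by apply/funext => x; rewrite /diff subr0.
Qed.

(** The [s] for which [diff s u] has vanishing k-fold differences form a subgroup, because
    [diff (s - t) u] is [diff s u - diff t u] translated by [-t]. *)
Lemma nil_diff_generates (S : seq G) k u : generates S ->
  (forall s, s \in S -> nil_diff k (diff s u)) -> nil_diff k.+1 u.
Proof.
move=> gS uS; apply: (gS (fun s => nil_diff k (diff s u))) => //.
  rewrite (_ : diff 0 u = fun=> 0); first exact: nil_diff_const0.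
  by apply/funext => x; rewrite /diff addr0 subrr.
move=> s t us ut.
have -> : diff (s - t) u = (fun x => (fun x => diff s u x - diff t u x) (x - t)).
  apply/funext => x; rewrite /diff subrK opprB [RHS]addrA subrK.
  by rewrite -addrA (addrC (- t)).
by apply: (@nil_diff_translate _ (- t) (fun x => _ - _)); apply: nil_diffB.
Qed.

(* By induction [D_w u] is constant along [w], so that
   [0 = u (x + n w) - u x = n (D_w u) x]. *)
Lemma nil_diff_torsion k u w n :
  nil_diff k u -> (forall (v : V), v *+ n.+1 = 0 -> v = 0) -> w *+ n.+1 = 0 ->
  forall x, diff w u x = 0.
Proof.
move=> uk V0 w0; elim: k u uk => [|k IH] u /= uk x; first by rewrite /diff !uk subrr.
have dd := IH _ (uk w).
have dc j : diff w u (x + w *+ j) = diff w u x.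
  elim: j => [|j <-]; first by rewrite addr0.
  by apply/eqP; rewrite -subr_eq0 mulrSr addrA; apply/eqP/dd.
apply: V0; rewrite -[RHS](subrr (u x)) -{2}[x]addr0 -w0.
elim: n.+1 => [|j IHj]; first by rewrite addr0 subrr.
by rewrite [LHS]mulrSr IHj -(dc j) /diff mulrSr addrC subrKA addrA.
Qed.

End Difference.

Lemma nil_diff_comp (G H V : zmodType) (h : H -> G) k (u : G -> V) :
  {morph h : x y / x + y} -> nil_diff k u -> nil_diff k (u \o h).
Proof.
move=> hD; elim: k u => [|k IH] u /= uk; first by move=> x; rewrite /= uk.
move=> s; rewrite (_ : diff s _ = diff (h s) u \o h); first exact: IH.
by apply/funext => x; rewrite /diff /= hD.
Qed.

(** * The energies [L^k (u^2)] *)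

Section Energy.
Variables (R : realType) (G : zmodType) (S : seq G).
Implicit Types (u h : G -> R) (x : G).

(** Written as a sum of squares, which makes nonnegativity immediate; [laplacian_energy] identifies
    it with [L^k (u^2)] for harmonic [u]. *)
Fixpoint energy (k : nat) u x : R :=
  if k is k'.+1 then \sum_(s <- S) energy k' (diff s u) x else u x ^+ 2.

Lemma energy_ge0 k u x : 0 <= energy k u x.
Proof.
elim: k u => [|k IH] u /=; first exact: sqr_ge0.
by apply: sumr_ge0 => s _; apply: IH.
Qed.

Lemma energy_eq0 k u : generates S -> (forall x, energy k u x = 0) -> nil_diff k u.
Proof.
move=> gS; elim: k u => [|k IH] u u0.
  by move=> x; apply/eqP; rewrite -sqrf_eq0; apply/eqP/u0.
apply: (nil_diff_generates gS) => s sS; apply: IH => x.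
have /eqP := u0 x; rewrite /= psumr_eq0 => [/allP/(_ s sS)/eqP//|t _].
exact: energy_ge0.
Qed.

Lemma laplacian_diff s u : (forall x, laplacian S u x = 0) ->
  forall x, laplacian S (diff s u) x = 0.
Proof.
move=> Lu x; rewrite -[RHS](subrr 0) -{1}(Lu (x + s)) -(Lu x) /laplacian -sumrB.
by apply: eq_bigr => t _; rewrite /diff (addrAC x); ring.
Qed.

Lemma laplacian_energy k u : (forall x, laplacian S u x = 0) ->
  forall x, laplacian S (energy k u) x = energy k.+1 u x.
Proof.
elim: k u => [|k IH] u Lu x.
  (* Termwise, [u(x+s)^2 - u(x)^2 = (D_s u)^2 + 2 u D_s u]. *)
  transitivity (energy 1 u x + 2 * u x * laplacian S u x).
    rewrite /= /laplacian mulr_sumr -[RHS]big_split.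
    by apply: eq_bigr => s _ /=; rewrite /diff; ring.
  by rewrite Lu mulr0 addr0.
rewrite /laplacian sumrB exchange_big [X in _ - X]exchange_big -sumrB /=.
apply: eq_bigr => s _; rewrite -[RHS]/(energy k.+1 (diff s u) x).
by rewrite -(IH _ (laplacian_diff s Lu)) /laplacian sumrB.
Qed.

(** The operator [N + L], with [N] the length of [S]. *)
Definition walk_sum (h : G -> R) x : R := \sum_(s <- S) h (x + s).

Lemma walk_sumE h x : walk_sum h x = (size S)%:R * h x + laplacian S h x.
Proof.
rewrite /laplacian sumrB big_const_seq count_predT iter_addr_0 mulr_natl.
by rewrite addrC subrK.
Qed.

Lemma walk_sum_lin (c : R) h h' x :
  walk_sum (fun y => c * h y + h' y) x = c * walk_sum h x + walk_sum h' x.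
Proof. by rewrite /walk_sum big_split mulr_sumr. Qed.

Lemma iter_walk_sum_lin n (c : R) h h' x :
  iter n walk_sum (fun y => c * h y + h' y) x
    = c * iter n walk_sum h x + iter n walk_sum h' x.
Proof.
elim: n x => [//|n IH] x; rewrite !iterS -walk_sum_lin; congr walk_sum.
by apply/funext.
Qed.

(* Expand [(N + L)^n] binomially, all terms being nonnegative. *)
Lemma energy_le_walk_sum n k j u x : (forall x, laplacian S u x = 0) ->
  'C(n, k)%:R * (size S)%:R ^+ n * energy (k + j) u x
    <= (size S)%:R ^+ k * iter n walk_sum (energy j u) x.
Proof.
move=> Lu; elim: n k j x => [|n IH] k j x.
  case: k => [|k]; rewrite /= ?bin0 ?bin0n ?expr0 ?mul1r ?mul0r //.
  by rewrite mulr_ge0 ?exprn_ge0 ?energy_ge0.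
rewrite iterSr (_ : walk_sum _ = fun y => (size S)%:R * energy j u y + energy j.+1 u y).
  rewrite iter_walk_sum_lin mulrDr.
  case: k => [|k].
    have := IH 0%N j x; rewrite !bin0 !expr0 !mul1r exprS -mulrA => H.
    apply: ler_wpDr; last by rewrite ler_wpM2l.
    have := IH 0%N j.+1 x; rewrite bin0 expr0 !mul1r; apply: le_trans.
    by rewrite mulr_ge0 ?exprn_ge0 ?energy_ge0.
  (* Pascal's rule splits ['C(n.+1, k.+1)]: [H1] serves the summand [N] of [N + L], and [H2] the
     summand [L], which raises [j] by one. *)
  have H1 := IH k.+1 j x; have H2 := IH k j.+1 x.
  rewrite binS natrD exprS addSn -addnS.
  have := ler_wpM2l (ler0n R (size S)) H1.
  have := ler_wpM2l (ler0n R (size S)) H2.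
  rewrite !exprS addSn -addnS; lra.
by apply/funext => y; rewrite walk_sumE laplacian_energy.
Qed.

(** There are [N^n] walks of [n] steps, and along each of them [l] grows by at most [n]. *)
Lemma iter_walk_sum_le (B : nat -> R) (l : G -> nat) h n x :
  (forall i j, (i <= j)%N -> B i <= B j) ->
  (forall (y s : G), s \in S -> (l (y + s)%R <= (l y).+1)%N) ->
  (forall y, h y <= B (l y)) ->
  iter n walk_sum h x <= (size S)%:R ^+ n * B (l x + n)%N.
Proof.
move=> Bmono lS hB; elim: n x => [|n IH] x; first by rewrite expr0 mul1r addn0.
rewrite iterS exprS -mulrA.
apply: (@le_trans _ _ (\sum_(s <- S) (size S)%:R ^+ n * B (l x + n.+1)%N)).
  rewrite /walk_sum big_seq [leRHS]big_seq; apply: ler_sum => s sS.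
  apply: le_trans (IH _) _; apply: ler_wpM2l; rewrite ?exprn_ge0 //.
  by apply: Bmono; rewrite addnS -addSn leq_add2r lS.
by rewrite big_const_seq count_predT iter_addr_0 mulr_natl.
Qed.

End Energy.

(** * Polynomial growth forces differences to vanish *)

Lemma expn_le_ffact t k : (t ^ k <= (t + k) ^_ k)%N.
Proof.
elim: k => [//|k IH]; rewrite addnS ffactSS expnS leq_mul //.
by rewrite leqW // leq_addr.
Qed.

(** Over walks of length [t + K + 1] the binomial coefficient grows like [t^(K+1)], the bound on
    [u^2] only like [t^K]; so [t] times the energy stays bounded. *)
Lemma energy_growth_eq0 (R : realType) (G : zmodType) (S : seq G) (u : G -> R)
    (l : G -> nat) (C : R) (K : nat) :
  (0 < size S)%N ->
  (forall x, laplacian S u x = 0) ->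
  (forall (y s : G), s \in S -> (l (y + s)%R <= (l y).+1)%N) ->
  (forall y, u y ^+ 2 <= C * ((l y).+1)%:R ^+ K) ->
  forall x, energy S K.+1 u x = 0.
Proof.
move=> S0 Lu lS uC x; apply/eqP; rewrite eq_le energy_ge0 andbT.
have N0 : (0 : R) < (size S)%:R by rewrite ltr0n.
have C0 : 0 <= C.
  have := le_trans (sqr_ge0 _) (uC x); rewrite pmulr_lge0 // exprn_gt0 //.
set k := K.+1; set N : R := (size S)%:R.
(* [k!] comes from the binomial coefficient, [N^k] from [energy_le_walk_sum], and [2^K] from the
   radius bound below. *)
set A := (k`!)%:R * (N ^+ k * C * 2 ^+ K).
have A0 : 0 <= A by rewrite !mulr_ge0 // ?exprn_ge0 // ltW.
(* This range of [t] gives [l x + (t + k) + 1 <= 2 t]. *)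
have key t : (l x + k < t)%N -> t%:R * energy S k u x <= A.
  move=> xt; have t0 : (0 : R) < t%:R by rewrite ltr0n; lia.
  have := energy_le_walk_sum (t + k) k 0 x Lu; rewrite addn0 -/N.
  have := @iter_walk_sum_le R G S (fun i => C * (i.+1)%:R ^+ K) l (energy S 0 u)
    (t + k)%N x _ lS uC.
  rewrite -/N; set W := iter _ _ _ x => W1 W2.
  have {W1} W1 : W <= N ^+ (t + k) * (C * (2 * t%:R) ^+ K).
    apply: le_trans (W1 _) _.
      move=> i j ij; rewrite ler_wpM2l // lerXn2r ?nnegrE // ler_nat; lia.
    rewrite ler_wpM2l ?exprn_ge0 // ler_wpM2l // lerXn2r ?nnegrE ?mulr_ge0 //.
    by rewrite -natrM ler_nat; lia.
  have {W1 W2} W3 : 'C(t + k, k)%:R * energy S k u x <= N ^+ k * C * (2 * t%:R) ^+ K.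
    have NN : 0 < N ^+ (t + k) by rewrite exprn_gt0.
    rewrite -(ler_pM2l NN); apply: le_trans (le_trans W2 _).
      by rewrite mulrCA mulrA.
    apply: le_trans (ler_wpM2l _ W1) _; first by rewrite exprn_ge0.
    by rewrite mulrCA -!mulrA.
  have W4 : t%:R ^+ k * energy S k u x
      <= (k`!)%:R * (N ^+ k * C * (2 * t%:R) ^+ K).
    apply: le_trans (ler_wpM2l (ler0n R k`!) W3).
    rewrite mulrA -natrM mulnC bin_ffact -natrX ler_wpM2r ?energy_ge0 //.
    by rewrite ler_nat expn_le_ffact.
  have tK : 0 < t%:R ^+ K :> R by rewrite exprn_gt0.
  rewrite -(ler_pM2l tK); apply: le_trans (le_trans W4 _).
    by rewrite /k exprSr mulrA.
  by rewrite le_eqVlt; apply/orP; left; apply/eqP; rewrite /A exprMn; ring.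
rewrite leNgt; apply/negP => E0.
(* A [t] beyond [A / energy] contradicts the bound. *)
have := key (maxn (l x + k).+1 (Num.bound (A / energy S k u x)).+1) (leq_maxl _ _).
apply/negP; rewrite -ltNge -ltr_pdivrMr //.
apply: lt_le_trans (archi_boundP _) _; first by rewrite divr_ge0 // ltW.
by rewrite ler_nat leq_max leqnSn orbT.
Qed.

Lemma harmonic_growth_bound_ge0 (R : realType) (G : zmodType) (S : seq G) (d : R)
    (o : G) (u : G -> R) C :
  (forall x, `|u x| <= C * ((word_dist S o x)%:R + 1) `^ d) -> 0 <= C.
Proof.
move=> uC; have := le_trans (normr_ge0 _) (uC o).
by rewrite pmulr_lge0 // powR_gt0 // ltr_wpDl.
Qed.

Lemma harmonic_growth_nil_diff (R : realType) (G : zmodType) (S : seq G) (d : R)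
    (o : G) (u : G -> R) :
  sym_generating S -> (0 < size S)%N -> 0 <= d ->
  harmonic_growth S d o u -> exists k, nil_diff k u.
Proof.
move=> gS S0 d0 [Lu [C uC]].
have C0 := harmonic_growth_bound_ge0 uC.
(* A natural number above [d] can replace the real exponent, the base being at least 1; squaring [u]
   doubles it. *)
pose K := Num.bound d.
exists (K * 2).+1; apply: (energy_eq0 gS.2).
apply: (@energy_growth_eq0 _ _ _ _ (word_dist S o) (C ^+ 2)) => // [y s|y].
  exact: word_distDr.
rewrite -real_normK ?num_real // exprM -exprMn lerXn2r ?nnegrE ?mulr_ge0 ?exprn_ge0 //.
apply: le_trans (uC y) _; rewrite ler_wpM2l // -natr1 -powR_mulrn ?addr_ge0 //.
apply: ler_powR; first by rewrite lerDr.
exact/ltW/archi_boundP.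
Qed.

(** * Newton expansion *)

Section Newton.
Variable R : realType.

(** The binomial coefficient [t(t-1)...(t-i+1)/i!] as a polynomial in a real [t], so that negative
    integers are covered. *)
Fixpoint gen_binom (i : nat) (t : R) : R :=
  if i is i'.+1 then gen_binom i' t * (t - i'%:R) / i%:R else 1.

Lemma gen_binomS0 i : gen_binom i.+1 0 = 0.
Proof.
elim: i => [|i IH]; first by rewrite /= subrr mulr0 mul0r.
by rewrite [LHS]/= -/(gen_binom i.+1 0) IH !mul0r.
Qed.

Lemma gen_binomSD1 i t : gen_binom i.+1 (t + 1) = gen_binom i.+1 t + gen_binom i t.
Proof.
elim: i => [|i IH]; first by rewrite /= !subr0 !mul1r invr1 !mulr1.
have i1 : i.+1%:R != 0 :> R by rewrite pnatr_eq0.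
have i2 : i.+2%:R != 0 :> R by rewrite pnatr_eq0.
have -> : gen_binom i.+2 (t + 1) = gen_binom i.+1 (t + 1) * (t + 1 - i.+1%:R) / i.+2%:R by [].
rewrite IH /=; move: i1 i2; rewrite -!natr1 => i1 i2; field.
by rewrite i1 i2.
Qed.

Lemma newton_expansion (G : zmodType) k (u : G -> R) e x (t : int) : nil_diff k u ->
  u (x + e *~ t) = \sum_(i < k) gen_binom i t%:~R * iter i (diff e) u x.
Proof.
elim: k u t => [|k IH] u t uk; first by rewrite big_ord0 uk.
have recl (j : int) : \sum_(i < k.+1) gen_binom i j%:~R * iter i (diff e) u x
    = u x + \sum_(i < k) gen_binom i.+1 j%:~R * iter i (diff e) (diff e u) x.
  rewrite big_ord_recl mul1r; congr (_ + _).
  by apply: eq_bigr => i _; rewrite -iterSr.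
(* The defect of the expansion has period 1, by induction applied to [diff e u] and Pascal's rule;
   it vanishes at 0, hence at all integers. *)
pose F (j : int) :=
  u (x + e *~ j) - \sum_(i < k.+1) gen_binom i j%:~R * iter i (diff e) u x.
have FS (j : int) : F (j + 1) = F j.
  have := IH _ j (uk e); rewrite {1}/diff -addrA -{2}[e]mulr1z -mulrzDr.
  rewrite /F !recl rmorphD.
  under [in u _ - (_ + _)]eq_bigr => i _ do rewrite gen_binomSD1 mulrDl.
  rewrite big_split /= => <-; ring.
have F0 : F t = 0.
  elim/int_ind: t => [|n|n].
  - rewrite /F recl mulr0z addr0 big1 ?addr0 ?subrr // => i _.
    by rewrite gen_binomS0 mul0r.
  - by rewrite -[in F n.+1]addn1 PoszD FS.
  - by rewrite -(FS (- n.+1%:Z)) -addn1 PoszD opprD subrK.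
by apply/eqP; rewrite -subr_eq0; apply/eqP.
Qed.

End Newton.

(** * Polynomials on Z^m *)

Section Polynomial.
Variables (R : realType) (m : nat).
Implicit Types h : 'rV[int]_m -> R.

Lemma is_polynomial_cst (c : R) : is_polynomial (fun _ : 'rV[int]_m => c).
Proof. by exists (mpoly.mpolyC m c) => z; rewrite mpoly.mevalC. Qed.

Lemma is_polynomial_coord i : is_polynomial (fun z : 'rV[int]_m => (z 0 i)%:~R : R).
Proof. by exists (mpoly.mpolyX R (mpoly.mnm1 i)) => z; rewrite mpoly.mevalXU. Qed.

Lemma is_polynomialD h1 h2 :
  is_polynomial h1 -> is_polynomial h2 -> is_polynomial (fun z => h1 z + h2 z).
Proof. by move=> [P hP] [Q hQ]; exists (P + Q) => z; rewrite mpoly.mevalD hP hQ. Qed.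

Lemma is_polynomialM h1 h2 :
  is_polynomial h1 -> is_polynomial h2 -> is_polynomial (fun z => h1 z * h2 z).
Proof. by move=> [P hP] [Q hQ]; exists (P * Q) => z; rewrite mpoly.mevalM hP hQ. Qed.

Lemma is_polynomial_sum k (F : 'I_k -> 'rV[int]_m -> R) :
  (forall i, is_polynomial (F i)) -> is_polynomial (fun z => \sum_(i < k) F i z).
Proof.
elim: k F => [|k IH] F Fp.
  by under eq_fun do rewrite big_ord0; apply: is_polynomial_cst.
by under eq_fun do rewrite big_ord_recl; apply: is_polynomialD; last exact: IH.
Qed.

Lemma is_polynomial_gen_binom k i :
  is_polynomial (fun z : 'rV[int]_m => gen_binom k ((z 0 i)%:~R : R)).
Proof.
elim: k => [|k IH] /=; first exact: is_polynomial_cst.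
apply: is_polynomialM (is_polynomial_cst _); apply: is_polynomialM => //.
exact: is_polynomialD (is_polynomial_coord i) (is_polynomial_cst _).
Qed.

Definition truncate (j : nat) (z : 'rV[int]_m) : 'rV[int]_m :=
  \row_i (if (i < j)%N then z 0 i else 0).

Lemma nil_diff_iter k i (e : 'rV[int]_m) h : nil_diff k h -> nil_diff k (iter i (diff e) h).
Proof.
move=> hk; elim: i => [//|i IH] /=; move: (iter _ _ _) IH => {hk}h hk.
exact: nil_diffB (nil_diff_translate e hk) hk.
Qed.

(** Induction on the number of coordinates kept: the Newton coefficients along one basis vector
    again have vanishing differences, and depend on one coordinate fewer. *)
Lemma nil_diff_polynomial k h : nil_diff k h -> is_polynomial h.
Proof.
move=> hk; suff H j : (j <= m)%N -> is_polynomial (h \o truncate j).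
  have -> : h = h \o truncate m; last exact: H.
  by apply/funext => z /=; congr h; apply/rowP => i; rewrite mxE ltn_ord.
elim: j h hk => [|j IH] h hk jm.
  rewrite (_ : _ \o _ = fun=> h 0); first exact: is_polynomial_cst.
  by apply/funext => z /=; congr h; apply/rowP => i; rewrite !mxE.
pose i0 := Ordinal jm.
rewrite (_ : _ \o _ = fun z : 'rV[int]_m => \sum_(i < k) gen_binom i (z 0 i0)%:~R
                             * (iter i (diff (delta_mx 0 i0)) h \o truncate j) z).
  apply: is_polynomial_sum => i; apply: is_polynomialM (is_polynomial_gen_binom _ _) _.
  by apply: IH (ltnW jm); apply: nil_diff_iter.
(* [truncate j.+1 z] is [truncate j z] plus [z 0 i0] times the basis vector. *)
apply/funext => z /=; rewrite -(newton_expansion (delta_mx 0 i0) _ (z 0 i0) hk).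
congr h; apply/rowP => i; rewrite mxE -scaler_int !mxE ltnS leq_eqVlt.
rewrite eqxx -val_eqE /= intz; case: eqVneq => [ij|_] /=.
  by rewrite ij ltnn mulr1 add0r; congr (z _ _); apply: val_inj.
by rewrite mulr0 addr0.
Qed.

End Polynomial.

(** * Torsion, change of base point and comparison of the two spaces *)

Lemma iso_cyclic_sum_torsion l (q : 'I_l -> nat) (A : zmodType) :
  iso_cyclic_sum q A -> exists n, forall x : A, x *+ n.+1 = 0.
Proof.
move=> [psi [psi_bij psiD]].
(* [(Zp_trunc n).+2] is the modulus that ['Z_n] carries by definition, so the product kills every
   component. *)
pose N := (\prod_(i < l) (Zp_trunc (q i)).+2)%N.
have N0 : (0 < N)%N by apply: prodn_gt0.
have psi0 i : psi 0 i = 0 by apply: (addIr (psi 0 i)); rewrite -psiD !add0r.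
have psiMn x n i : psi (x *+ n) i = psi x i *+ n.
  by elim: n => [|n IH]; rewrite ?mulr0n ?psi0 // !mulrS psiD IH.
exists N.-1 => x; apply: (bij_inj psi_bij); apply/ffunP => i.
rewrite psiMn psi0 prednK // /N (bigD1 i) //= mulrnA.
have -> : psi x i *+ (Zp_trunc (q i)).+2 = 0; last by rewrite mul0rn.
by rewrite Zp_mulrn; apply: val_inj; rewrite /= modnMl.
Qed.

(** Since [c + j + 1 <= (c + 1)(j + 1)], moving the base point by distance [c] costs only the
    constant factor [(c + 1)^d]. *)
Lemma growth_change_dist (R : realType) (d C v : R) (i j c : nat) : 0 <= d -> 0 <= C ->
  (i <= c + j)%N -> v <= C * (i%:R + 1) `^ d ->
  v <= C * (c%:R + 1) `^ d * (j%:R + 1) `^ d.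
Proof.
move=> d0 C0 ij; move/le_trans; apply; rewrite -mulrA ler_wpM2l // -powRM ?addr_ge0 //.
apply: ge0_ler_powR => //; rewrite ?nnegrE ?mulr_ge0 ?addr_ge0 //.
by rewrite !natr1 -natrM ler_nat; nia.
Qed.

Theorem theorem1p2 (R : realType) (m l : nat) (hm : (1 <= m)%N)
    (p a : 'I_l -> nat)
    (hp : forall i, prime (p i)) (ha : forall i, (0 < a i)%N)
    (G1 G2 : zmodType)
    (phi : {additive 'rV[int]_m -> G1}) (hphi : bijective phi)
    (hG2 : iso_cyclic_sum (fun i => p i ^ a i)%N G2)
    (S : seq (G1 * G2)%type) (hS : sym_generating S)
    (d : R) (hd : 0 <= d) (o : (G1 * G2)%type) (o1 : G1) :
  harmonic_growth S d o
    = [set (fun x : G1 * G2 => g x.1)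
        | g in harmonic_growth [seq s.1 | s <- S] d o1]
  /\ (forall f : G1 * G2 -> R, harmonic_growth S d o f ->
        is_polynomial (fun z : 'rV[int]_m => f (phi z, 0))
        /\ forall (x : G1 * G2) (w : G2), f (x + (0, w)) = f x).
Proof.
(* Here [m >= 1] enters: an empty list generates only 0, while [phi] of the all-ones vector is
   nonzero. *)
have S0 : (0 < size S)%N.
  rewrite lt0n; apply/negP => /nilP S0; have [_] := hS; rewrite S0 => gS.
  have /(bij_inj hphi)/rowP/(_ (Ordinal hm)) :
      phi (const_mx 1) = phi 0; last by rewrite !mxE.
  rewrite raddf0.
  by apply: (gS (fun x => x.1 = 0) _ _ _ (phi (const_mx 1), 0)) =>
    //= x y -> ->; rewrite subr0.
have [N torN] := iso_cyclic_sum_torsion hG2.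
have inv (f : G1 * G2 -> R) : harmonic_growth S d o f ->
    forall x w, f (x + (0, w)) = f x.
  move=> /(harmonic_growth_nil_diff hS S0 hd)[k fk] x w; apply/eqP; rewrite -subr_eq0.
  (* [(0, w)] is torsion and the reals are torsion-free, so the difference along it vanishes. *)
  apply/eqP/(@nil_diff_torsion _ _ k f (0, w) N fk) => [v /eqP|].
    by rewrite mulrn_eq0 => /eqP.
  by rewrite [LHS]surjective_pairing !raddfMn /= mul0rn torN.
have invE (f : G1 * G2 -> R) : harmonic_growth S d o f -> forall x w, f (x.1, w) = f x.
  move=> /inv fi [x1 x2] w; rewrite -(fi (x1, x2) (w - x2)); congr f.
  by apply/pair_equal_spec; rewrite /= addr0 addrC subrK.
have gS1 := sym_generating_fst hS.
split; last first.
  move=> f Hf; split; last exact: inv.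
  have [k fk] := harmonic_growth_nil_diff hS S0 hd Hf.
  apply: (nil_diff_polynomial (nil_diff_comp (h := fun z => (phi z, 0)) _ fk)) => y z.
  by rewrite raddfD -[in LHS](addr0 0).
(* The pullback of [g] comes first: projection only shrinks distances, so the growth bound survives
   up to the change of base point. *)
apply/seteqP; split => [f Hf|_ [g [Lg [C gC]] <-]]; last first.
  split=> [x|]; first by rewrite -(Lg x.1) /laplacian big_map.
  have C0 := harmonic_growth_bound_ge0 gC.
  exists (C * ((word_dist [seq s.1 | s <- S] o1 o.1)%:R + 1) `^ d) => x.
  apply: growth_change_dist hd C0 _ (gC x.1).
  apply: leq_trans (word_distD o1 o.1 x.1 gS1) _.
  by rewrite leq_add2l word_dist_fst.
have [Lf [C fC]] := Hf; have C0 := harmonic_growth_bound_ge0 fC.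
exists (fun x1 => f (x1, 0)); last by apply/funext => x; rewrite invE.
split=> [x|].
  rewrite -(Lf (x, 0)) /laplacian big_map; apply: eq_bigr => s _.
  by rewrite -(invE _ Hf ((x, 0) + s) 0).
exists (C * ((word_dist [seq s.1 | s <- S] o.1 o1)%:R + 1) `^ d) => x.
(* Growth is estimated at [(x, y2)], the end of a lifted shortest walk, where [f] takes the same
   value as at [(x, 0)]. *)
have [y2 xy] := word_dist_lift o x hS.
rewrite -(invE _ Hf (x, 0) y2) /=.
apply: growth_change_dist hd C0 _ (fC (x, y2)).
exact: leq_trans xy (word_distD _ o1 _ gS1).
Qed.
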